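(* Let $n_0\ge 5$ be an integer. Then for all integers $n\ge n_0$, $$\sup_{x\in\mathbb{R}}\bigl|\Phi^n\bigl(a_n^\circ\,x+b_n\bigr)-\Lambda(x)\bigr|<\frac{C(n_0)}{\log n},$$ where $$C(n_0)=\begin{cases}1, & \text{when } n_0\le 15,\\[4pt] \Bigl(\dfrac{2}{3b_{n_0}^2}+\dfrac{1}{\sqrt{e}\,n_0}\Bigr)\log(n_0)<1, & \text{when } n_0\ge 16\end{cases}$$ (in particular, the inequality $C(n_0)<1$ for $n_0\ge 16$ is part of the statement). Moreover, $\lim_{n_0\to\infty}C(n_0)=1/3$.
   Context: $\Phi$ is the distribution function of the standard normal law, $\Phi^n(y)$ means $(\Phi(y))^n$, and $\Lambda(x)=\exp\{-e^{-x}\}$, $x\in\mathbb{R}$, is the Gumbel distribution function. The norming constants are $b_n=\Phi^{-1}(1-\frac1n)$ and $a_n^\circ=\dfrac{b_n}{1+b_n^2}$. Here $\log$ is the natural logarithm. *)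

(* Defs.v *)
From mathcomp Require Import all_boot all_order all_algebra.
From mathcomp Require Import all_classical all_reals all_analysis.
Set Implicit Arguments.
Unset Strict Implicit.
Unset Printing Implicit Defensive.
Import Order.TTheory GRing.Theory Num.Theory.
Import numFieldNormedType.Exports.
Local Open Scope classical_set_scope.
Local Open Scope ring_scope.

Definition Phi {R : realType} (x : R) : R :=
  fine (normal_prob (0 : R) (1 : R) `]-oo, x]).

(* The inverse function of Phi. Phi is a bijection from R onto ]0, 1[, so for
   p in ]0, 1[ this is the unique x with Phi x = p; the default value 0 is only
   taken outside ]0, 1[. *)
Definition Phi_inv {R : realType} (p : R) : R :=
  xget 0 [set x : R | Phi x = p].

Definition Lambda {R : realType} (x : R) : R := expR (- expR (- x)).

Definition b_ {R : realType} (n : nat) : R := Phi_inv (1 - 1 / n%:R).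

Definition acirc {R : realType} (n : nat) : R := b_ n / (1 + b_ n ^+ 2).

Definition Cbound {R : realType} (n0 : nat) : R :=
  if (n0 <= 15)%N then 1
  else (2 / (3 * b_ n0 ^+ 2) + 1 / (Num.sqrt (expR 1) * n0%:R)) * ln n0%:R.

(* Main.v *)
From HB Require Import structures.
Require Import Defs.
From mathcomp Require Import all_boot all_order all_algebra.
From mathcomp Require Import all_classical all_reals all_analysis.
From mathcomp Require Import ring lra zify.
Set Implicit Arguments.
Unset Strict Implicit.
Unset Printing Implicit Defensive.
Import Order.TTheory GRing.Theory Num.Theory.
Import numFieldNormedType.Exports.
Local Open Scope classical_set_scope.
Local Open Scope ring_scope.

(** Write Q = 1 - Phi, phi = Phi' and b = b_ n, so that Q b = 1 / n and b > 0.
With q x = n Q (a x + b), where a = b / (1 + b^2), the distribution function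
of the normalised maximum at x is exactly (1 - q x / n)^n, while
Lambda x = exp (- e^-x). Two errors have to be controlled.

The first one replaces (1 - q / n)^n by e^-q. It is one-sided and at most
sup_q (q^2 e^-q) / n <= (4/7) / n ([expRN_le_pow]), which accounts for the term
1 / (sqrt e n) of the constant.

The second one replaces q x by e^-x. Since - ln (q x) is the increment of the
cumulative hazard - ln Q between b and b + a x, it is governed by the hazard
rate lambda = phi / Q (the inverse Mills ratio). Everything needed about lambda
follows from three inequalities for Q, obtained by showing that a suitable
expression is monotone and has limit 0 at infinity: [phi_Q_lower],
[phi_Q_upper] and [phi_Q_quadratic]. They say that lambda is nondecreasing with
slope at most 1, and that lambda b lies between b + b / (b^2 + 2) and b + 1 / b.
The scale a is the inverse of the latter, so that with
deficit = 2 / ((b^2 + 1) (b^2 + 2)), which is of order b^-4,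
  (1 - deficit) x <= - ln (q x) <= x + a^2 x^2 / 2        for x >= 0,
  (1 - deficit) s - a^2 s^2 / 2 <= ln (q (- s)) <= s      for s >= 0
([tail_ratio_right], [tail_ratio_left]). Because x^2 e^-x (for x >= 0) and
q (ln q)^2 e^-q (for q >= 1) are bounded, the second error is of order b^-2,
with a constant below the required 2/3 ([deviation_large]). Far to the left, in
the region where the quadratic term a^2 s^2 dominates, both distribution
functions are already tiny, by monotonicity.

It remains to compare with C(n0) / ln n. Here ln n = - ln Q b, and both
ln n / n and - ln Q b / b^2 are nonincreasing, so C decreases from 16 on and
  only
C(16) < 1 has to be evaluated; for 5 <= n <= 15 the deviation is bounded by
numbers below 1 / ln n. The few quantiles that enter (b_ 5 >= 3/4, b_ 8 >= 1,
b_ 16 >= 3/2) come from [phi_Q_quadratic], which bounds Q from below by an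
explicit function of phi, together with pi <= 16/5. Finally b_ n tends to
infinity and (b^2 + 1) / 2 <= ln n <= b^2 / 2 + O(b), whence C tends to
(2/3) (1/2) = 1/3. *)

(** * Derivatives and the normal density *)

Section Calculus.
Context {R : realType}.
Implicit Types (f g df : R -> R) (a b c x : R).

(** A plain conjunction instead of the class [is_derive]: instance resolution
would otherwise instantiate the derivative while it is still an unknown to be
computed by applying the rules below. *)
Definition derives f x a := derivable f x 1 /\ 'D_1 f x = a.

Lemma derivesP f x a : derives f x a <-> is_derive x 1 f a.
Proof. by split => [[]//|[]]. Qed.

Lemma derives_eq f x a b : derives f x a -> a = b -> derives f x b.
Proof. by move=> fa <-. Qed.

Lemma derives_add f g x a b : derives f x a -> derives g x b ->
  derives (fun y => f y + g y) x (a + b).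
Proof. by move=> /derivesP fa /derivesP gb; apply/derivesP;
  exact: is_deriveD. Qed.

Lemma derives_opp f x a : derives f x a -> derives (fun y => - f y) x (- a).
Proof. by move=> /derivesP fa; apply/derivesP; exact: is_deriveN. Qed.

Lemma derives_mul f g x a b : derives f x a -> derives g x b ->
  derives (fun y => f y * g y) x (f x * b + g x * a).
Proof. by move=> /derivesP fa /derivesP gb; apply/derivesP;
  exact: is_deriveM. Qed.

Lemma derives_pow f x a n : derives f x a ->
  derives (fun y => f y ^+ n) x (n%:R * f x ^+ n.-1 * a).
Proof.
move=> /derivesP fa; apply/derivesP; have := @is_deriveX _ _ f n x 1 a fa.
by rewrite exprfctE.
Qed.

Lemma derives_inv f x a : f x != 0 -> derives f x a ->
  derives (fun y => (f y)^-1) x (- (f x) ^- 2 * a).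
Proof. by move=> f0 /derivesP fa; apply/derivesP; exact: is_deriveV. Qed.

Lemma derives_chain f g x a b : derives f x a -> derives g (f x) b ->
  derives (fun y => g (f y)) x (b * a).
Proof.
by move=> /derivesP fa /derivesP gb; apply/derivesP;
  exact: is_derive1_comp gb fa.
Qed.

Lemma derives_const c x : derives (fun=> c) x 0.
Proof. by apply/derivesP; exact: is_derive_cst. Qed.

Lemma derives_id x : derives (fun y : R => y) x 1.
Proof. by apply/derivesP; exact: is_derive_id. Qed.

Lemma derives_expR x : derives (@expR R) x (expR x).
Proof. by apply/derivesP; exact: is_derive_expR. Qed.

Lemma derives_ln x : 0 < x -> derives (@ln R) x x^-1.
Proof. by move=> x0; apply/derivesP; exact: is_derive1_ln. Qed.

Lemma derives_continuous f x a : derives f x a -> {for x, continuous f}.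
Proof.
by move=> [fa _]; exact/differentiable_continuous/derivable1_diffP.
Qed.

Lemma derive_ge0_ndecr f df a b : a <= b ->
  (forall x, a <= x <= b -> derives f x (df x)) ->
  (forall x, a <= x <= b -> 0 <= df x) -> f a <= f b.
Proof.
move=> ab fdf df0.
have [||c cab fE] := @MVT_segment R f df a b ab.
- by move=> x; rewrite in_itv/= => /andP[/ltW ? /ltW ?];
  apply/derivesP/fdf/andP.
- apply/derivable_within_continuous => x; rewrite in_itv/= => xab.
  by case: (fdf x xab).
- rewrite -subr_ge0 fE mulr_ge0 ?subr_ge0//; apply: df0.
  by move: cab; rewrite in_itv.
Qed.

Lemma derive_le0_nincr f df a b : a <= b ->
  (forall x, a <= x <= b -> derives f x (df x)) ->
  (forall x, a <= x <= b -> df x <= 0) -> f b <= f a.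
Proof.
move=> ab fdf df0; rewrite -lerN2.
apply: (@derive_ge0_ndecr (fun x => - f x) (fun x => - df x)) => // x xab.
  by apply: derives_opp; exact: fdf.
by rewrite oppr_ge0 df0.
Qed.

(** All integral estimates below take this form: an inequality between
derivatives integrates to one between increments. *)
Lemma derive_le_increment f g df dg a b : a <= b ->
  (forall x, a <= x <= b -> derives f x (df x)) ->
  (forall x, a <= x <= b -> derives g x (dg x)) ->
  (forall x, a <= x <= b -> df x <= dg x) -> f b - f a <= g b - g a.
Proof.
move=> ab fdf gdg dfg.
suff : g a - f a <= g b - f b by lra.
apply: (@derive_ge0_ndecr (fun x => g x - f x) (fun x => dg x - df x)) =>
  // x xab.
  by apply: derives_add; [exact: gdg|exact/derives_opp/fdf].
by rewrite subr_ge0 dfg.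
Qed.

End Calculus.

Section Normal.
Context {R : realType}.
Implicit Types x t : R.

Definition phi (x : R) : R := normal_pdf 0 1 x.

Lemma phiE x : phi x = (Num.sqrt (2 * pi))^-1 * expR (- (x ^+ 2 / 2)).
Proof.
rewrite /phi normal_pdfE ?oner_eq0// /normal_peak /normal_fun subr0.
by rewrite !expr1n mul1r -mulr_natl mulNr.
Qed.

Lemma derives_Phi x : derives Phi x (phi x).
Proof.
have xx1 : x < x + 1 by rewrite ltrDl.
have int : (@lebesgue_measure R).-integrable [set` `]-oo, (x + 1)]]
    (EFin \o normal_pdf 0 1).
  by apply: integrableS (integrable_normal_pdf 0 1).
have [||D E] := continuous_FTC1 xx1 int.
- by rewrite ltNyr.
- by apply: continuous_normal_pdf; rewrite oner_eq0.
by split; [exact: D|rewrite -derive1E; exact: E].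
Qed.

(* The identity as a random variable under the normal law: its distribution
   function is Phi, which gives the limit at infinity. *)
Let idR : measurableTypeR R -> R := idfun.

HB.instance Definition _ :=
  @isMeasurableFun.Build _ _ _ _ idR (@measurable_id _ _ setT).

Lemma Phi_cvg1 : Phi x @[x --> +oo] --> (1 : R).
Proof.
by apply/fine_cvg; have := cvg_cdfy1 (idR : {RV normal_prob (0 : R) 1 >-> R}).
Qed.

Lemma derives_phi x : derives phi x (- (x * phi x)).
Proof.
have -> : phi = (fun x => (Num.sqrt (2 * pi))^-1 * expR (- (x ^+ 2 * 2^-1))).
  by apply/funext => y; rewrite phiE.
apply: derives_eq.
  apply: derives_mul; first exact: derives_const.
  apply: derives_chain; last exact: derives_expR.
  apply/derives_opp/derives_mul; last exact: derives_const.
  exact/derives_pow/derives_id.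
rewrite /=; move: (Num.sqrt _)^-1 (expR _) => c e; by field.
Qed.

Lemma phi_gt0 x : 0 < phi x.
Proof. by rewrite phiE mulr_gt0 ?expR_gt0// invr_gt0 sqrtr_gt0 mulr_gt0//
  pi_gt0. Qed.

End Normal.

(** * Mills ratio inequalities *)

Section Tail.
Context {R : realType}.
Implicit Types x t : R.

Definition Q x : R := 1 - Phi x.

Lemma derives_Q x : derives Q x (- phi x).
Proof.
apply: derives_eq; first exact: derives_add (derives_const _ _) (derives_opp
  (derives_Phi x)).
by rewrite add0r.
Qed.

Lemma Phi_lt x t : x < t -> Phi x < Phi t.
Proof.
move=> xt.
have [||c _ E] := @MVT R Phi phi x t xt.
- by move=> y _; apply/derivesP; exact: derives_Phi.
- apply/derivable_within_continuous => y _.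
  by case: (derives_Phi y).
- by rewrite -subr_gt0 E mulr_gt0 ?phi_gt0 ?subr_gt0.
Qed.

Lemma Phi_ge0 x : 0 <= Phi x.
Proof. exact: fine_ge0. Qed.

Lemma Phi_le1 x : Phi x <= 1.
Proof. by rewrite /Phi -fine1 fine_le ?fin_num_measure// probability_le1. Qed.

Lemma Q_gt0 x : 0 < Q x.
Proof.
rewrite subr_gt0; apply: (@lt_le_trans _ _ (Phi (x + 1))); last exact: Phi_le1.
by apply: Phi_lt; rewrite ltrDl.
Qed.

Lemma Q_le1 x : Q x <= 1.
Proof. by rewrite /Q gerBl Phi_ge0. Qed.

Lemma Q_lt x t : x < t -> Q t < Q x.
Proof. by move=> /Phi_lt ?; rewrite ltrD2l ltrN2. Qed.

Lemma Q_le x t : x <= t -> Q t <= Q x.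
Proof. by rewrite le_eqVlt => /predU1P[->//|/Q_lt/ltW]. Qed.

Lemma phi_small (e : R) : 0 < e -> \forall t \near +oo, phi t <= e.
Proof.
move=> e0; set c := (Num.sqrt (2 * pi) : R)^-1.
have c0 : 0 < c by rewrite invr_gt0 sqrtr_gt0 mulr_gt0// pi_gt0.
near=> t.
have t1 : 1 <= t by [].
have tc : 2 * c / e <= t by [].
have tt : t <= t ^+ 2 by rewrite expr2 ler_peMr// (le_trans ler01).
have et : t ^+ 2 / 2 <= expR (t ^+ 2 / 2) by have := expR_ge1Dx (t ^+ 2 / 2);
  lra.
rewrite phiE -/c expRN ler_pdivrMr ?expR_gt0// -ler_pdivrMl//.
apply: le_trans et; rewrite ler_pdivrMr// in tc.
have te : t * e <= t ^+ 2 * e by rewrite ler_pM2r.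
rewrite mulrC ler_pdivrMr//; lra.
Unshelve. all: by end_near. Qed.

Lemma Q_small (e : R) : 0 < e -> \forall t \near +oo, Q t <= e.
Proof.
move=> e0; have /cvgrPdist_le/(_ e e0) := @Phi_cvg1 R.
by apply: filterS => t; apply: le_trans; exact: ler_norm.
Qed.

(** An inequality that becomes an equality at infinity holds as soon as the
difference of its sides is nonincreasing. Bounding the difference from below by
- (phi + Q) makes it unnecessary to compute its limit. *)
Lemma tail_ge0 (f df : R -> R) a :
  (forall x, a <= x -> derives f x (df x)) ->
  (forall x, a <= x -> df x <= 0) ->
  (forall x, a <= x -> 0 < x -> - (phi x + Q x) <= f x) -> 0 <= f a.
Proof.
move=> fdf df0 fge; apply/ler_addgt0Pr => e e0; rewrite -lerBlDr sub0r.
have e2 : 0 < e / 2 by rewrite divr_gt0.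
near (+oo : set_system R) => T.
have aT : a <= T by [].
have T1 : 1 <= T by [].
have pT : phi T <= e / 2 by near: T; exact: phi_small.
have qT : Q T <= e / 2 by near: T; exact: Q_small.
apply: (@le_trans _ _ (f T)).
  by apply: le_trans (fge T aT _); [lra|exact: lt_le_trans T1].
by apply: (@derive_le0_nincr _ _ df) => // x /andP[ax _];
  [exact: fdf|exact: df0].
Unshelve. all: by end_near. Qed.

(** Second convergent of the continued fraction of the Mills ratio; the
derivative of the difference collapses to - 2 phi / (1 + x^2)^2. *)
Lemma phi_Q_lower t : 0 < t -> phi t * (t / (1 + t ^+ 2)) <= Q t.
Proof.
move=> t0; rewrite -subr_ge0.
apply: (@tail_ge0 (fun x => Q x - phi x * (x * (1 + x ^+ 2)^-1))
   (fun x => - 2 * phi x / (1 + x ^+ 2) ^+ 2)) => x tx.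
- have x1 : 1 + x ^+ 2 != 0 by rewrite gt_eqF// ltr_pwDl// sqr_ge0.
  apply: derives_eq.
    apply: derives_add; first exact: derives_Q.
    apply: derives_opp; apply: derives_mul; first exact: derives_phi.
    apply: derives_mul; first exact: derives_id.
    apply: derives_inv; first exact: x1.
    apply: derives_add; first exact: derives_const.
    exact: derives_pow (derives_id _).
  by rewrite /=; field.
- by rewrite -mulrA mulNr oppr_le0 mulr_ge0// divr_ge0 ?sqr_ge0// ltW ?phi_gt0.
- move=> x0; have p0 := phi_gt0 x; have q0 := Q_gt0 x.
  have : x * (1 + x ^+ 2)^-1 <= 1.
    by rewrite ler_pdivrMr ?mul1r ?ltr_pwDl ?sqr_ge0//; nra.
  move: (_ * _^-1) => r r1; nra.
Qed.

(** Third convergent of the same continued fraction; here the derivative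
is - 6 phi / (x (x^2 + 3))^2. *)
Lemma phi_Q_upper t : 0 < t ->
  Q t <= phi t * ((t ^+ 2 + 2) / (t * (t ^+ 2 + 3))).
Proof.
move=> t0; rewrite -subr_ge0.
apply: (@tail_ge0 (fun x =>
  phi x * ((x ^+ 2 + 2) * (x * (x ^+ 2 + 3))^-1) - Q x)
   (fun x => - 6 * phi x / (x * (x ^+ 2 + 3)) ^+ 2)) => x tx.
- have x0 : x != 0 by rewrite gt_eqF// (lt_le_trans t0).
  have x1 : x ^+ 2 + 3 != 0 by rewrite gt_eqF// ltr_wpDl// sqr_ge0.
  apply: derives_eq.
    apply: derives_add; last exact/derives_opp/derives_Q.
    apply: derives_mul; first exact: derives_phi.
    apply: derives_mul.
      apply: derives_add; last exact: derives_const.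
      exact: derives_pow (derives_id _).
    apply: derives_inv; first by rewrite mulf_neq0.
    apply: derives_mul; first exact: derives_id.
    apply: derives_add; last exact: derives_const.
    exact: derives_pow (derives_id _).
  by rewrite /=; field; rewrite x0 x1.
- by rewrite -mulrA mulNr oppr_le0 mulr_ge0// divr_ge0 ?sqr_ge0// ltW ?phi_gt0.
- move=> x0; have p0 := phi_gt0 x; have q0 := Q_gt0 x.
  have : 0 <= (x ^+ 2 + 2) * (x * (x ^+ 2 + 3))^-1.
    by rewrite divr_ge0 ?addr_ge0 ?mulr_ge0 ?addr_ge0 ?sqr_ge0// ltW.
  move: (_ * _^-1) => r r1; nra.
Qed.

Lemma Q_le_phi t : t * Q t <= phi t.
Proof.
have [t0|t0] := leP t 0.
  by apply: le_trans (ltW (phi_gt0 t)); rewrite mulr_le0_ge0// ltW// Q_gt0.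
have := phi_Q_upper t0; rewrite -(ler_pM2l t0) => /le_trans; apply.
rewrite mulrCA ler_piMr// ?(ltW (phi_gt0 t))//.
rewrite mulrA ler_pdivrMr ?mul1r; last by rewrite mulr_gt0// ltr_wpDl// sqr_ge0.
by rewrite ler_pM2l// lerD2l ler_nat.
Qed.

(** Birnbaum's lower bound for the Mills ratio, left in quadratic form: it
holds on the whole line and says that the hazard rate has slope at most 1. The
derivative of the difference is nonpositive by [phi_Q_lower]. *)
Lemma phi_Q_quadratic t : phi t ^+ 2 <= Q t ^+ 2 + t * phi t * Q t.
Proof.
rewrite -subr_ge0.
apply: (@tail_ge0 (fun x => Q x ^+ 2 + x * phi x * Q x - phi x ^+ 2)
   (fun x => phi x * (x * phi x - (1 + x ^+ 2) * Q x))) => x tx.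
- apply: derives_eq.
    apply: derives_add; last exact/derives_opp/derives_pow/derives_phi.
    apply: derives_add; first exact/derives_pow/derives_Q.
    apply: derives_mul; last exact: derives_Q.
    apply: derives_mul; last exact: derives_phi.
    exact: derives_id.
  by rewrite /=; ring.
- rewrite mulr_ge0_le0 ?(ltW (phi_gt0 _))// subr_le0.
  have x1 : 0 < 1 + x ^+ 2 by rewrite ltr_pwDl// sqr_ge0.
  have [x0|x0] := leP x 0.
    apply: (@le_trans _ _ 0); first by rewrite mulr_le0_ge0// ltW// phi_gt0.
    by rewrite mulr_ge0 ?(ltW x1)// ltW// Q_gt0.
  have := phi_Q_lower x0; rewrite mulrA ler_pdivrMr// => h.
  by rewrite mulrC (mulrC (1 + _)).
- move=> x0; have p0 := phi_gt0 x; have q0 := Q_gt0 x.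
  have k0 : 0 <= x * phi x * Q x by rewrite !mulr_ge0// ltW.
  have p1 : phi x <= 1.
    rewrite phiE -[leRHS]mulr1 ler_pM ?expR_ge0 ?invr_ge0 ?sqrtr_ge0//.
      rewrite invf_le1 ?sqrtr_gt0 ?mulr_gt0 ?pi_gt0// -[leLHS]sqrtr1
        ler_wsqrtr//.
      by have := @pi_ge2 R; lra.
    by rewrite expR_le1 oppr_le0 divr_ge0// sqr_ge0.
  have p2 : phi x ^+ 2 <= phi x by rewrite expr2 ler_piMr// ltW.
  by have q2 := sqr_ge0 (Q x); lra.
Qed.

End Tail.

(** * The hazard rate *)

Section Hazard.
Context {R : realType}.
Implicit Types t b h : R.

Definition hazard t : R := phi t / Q t.

(** The cumulative hazard; it takes the value ln n at b_ n. *)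
Definition cumhaz t : R := - ln (Q t).

Lemma derives_cumhaz t : derives cumhaz t (hazard t).
Proof.
apply: derives_eq.
  apply: derives_opp; apply: derives_chain; first exact: derives_Q.
  by apply: derives_ln; exact: Q_gt0.
by rewrite /hazard mulrN opprK mulrC.
Qed.

Lemma derives_hazard t : derives hazard t (hazard t * (hazard t - t)).
Proof.
apply: derives_eq.
  apply: derives_mul; first exact: derives_phi.
  apply: derives_inv; last exact: derives_Q.
  by rewrite gt_eqF// Q_gt0.
by rewrite /hazard; field; rewrite gt_eqF// Q_gt0.
Qed.

Lemma hazard_gt0 t : 0 < hazard t.
Proof. by rewrite divr_gt0 ?phi_gt0 ?Q_gt0. Qed.

Lemma hazard_ge_id t : t <= hazard t.
Proof. by rewrite ler_pdivlMr ?Q_gt0// Q_le_phi. Qed.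

(** The left-hand side is the derivative of the hazard rate, by
[derives_hazard]. *)
Lemma hazard_slope_le1 t : hazard t * (hazard t - t) <= 1.
Proof.
have q0 := Q_gt0 t; rewrite -(ler_pM2r (exprn_gt0 2 q0)) mul1r.
suff -> : hazard t * (hazard t - t) * Q t ^+ 2 = phi t ^+ 2 - t * phi t * Q t.
  by rewrite lerBlDr phi_Q_quadratic.
by rewrite /hazard; field; rewrite gt_eqF.
Qed.

Lemma hazard_le t : 0 < t -> hazard t <= t + t^-1.
Proof.
move=> t0; rewrite ler_pdivrMr ?Q_gt0//.
have -> : t + t^-1 = (1 + t ^+ 2) / t by field; rewrite gt_eqF.
have x1 : 0 < 1 + t ^+ 2 by rewrite ltr_pwDl// sqr_ge0.
have := phi_Q_lower t0; rewrite -(ler_pM2l (divr_gt0 x1 t0)).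
apply: le_trans; rewrite le_eqVlt; apply/orP; left; apply/eqP.
by field; rewrite !gt_eqF.
Qed.

Lemma hazard_ge t : 0 < t -> t * (t ^+ 2 + 3) / (t ^+ 2 + 2) <= hazard t.
Proof.
move=> t0.
have x3 : 0 < t ^+ 2 + 3 by rewrite ltr_wpDl// sqr_ge0.
have x2 : 0 < t ^+ 2 + 2 by rewrite ltr_wpDl// sqr_ge0.
rewrite ler_pdivrMr// mulrAC ler_pdivlMr ?Q_gt0//.
have := phi_Q_upper t0; rewrite mulrA ler_pdivlMr ?mulr_gt0//.
by rewrite mulrC.
Qed.

Lemma hazard_homo s t : s <= t -> hazard s <= hazard t.
Proof.
move=> st; apply: (@derive_ge0_ndecr _ _ (fun x =>
  hazard x * (hazard x - x))) => // x _.
  exact: derives_hazard.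
by rewrite mulr_ge0 ?(ltW (hazard_gt0 x))// subr_ge0 hazard_ge_id.
Qed.

Lemma hazard_sub_homo s t : s <= t -> hazard t - t <= hazard s - s.
Proof.
move=> st; apply: (@derive_le0_nincr _ (fun x => hazard x - x)
  (fun x => hazard x * (hazard x - x) - 1)) => // x _.
  by apply: derives_add; [exact: derives_hazard|exact/derives_opp/derives_id].
by rewrite subr_le0 hazard_slope_le1.
Qed.

Lemma derives_linear c x : derives (fun y : R => c * y) x c.
Proof.
apply: derives_eq.
  by apply: derives_mul; [exact: derives_const|exact: derives_id].
by rewrite mulr1 mulr0 addr0.
Qed.

Lemma derives_quadratic c x : derives (fun y : R =>
  c * y + y ^+ 2 / 2) x (c + x).
Proof.
apply: derives_eq.
  apply: derives_add; first exact: derives_linear.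
  apply: derives_mul; last exact: derives_const.
  by apply: derives_pow; exact: derives_id.
by rewrite /=; field.
Qed.

(** The next four lemmas integrate the monotonicity of the hazard rate, the
bound of its slope and, for [cumhaz_right_le], the bound x + 1 / x <= x + 1 / b
on [b, +oo[. *)
Lemma cumhaz_right_ge b h : 0 <= h ->
  hazard b * h <= cumhaz (b + h) - cumhaz b.
Proof.
move=> h0; have bh : b <= b + h by rewrite lerDl.
have -> : hazard b * h = hazard b * (b + h) - hazard b * b by ring.
apply: (@derive_le_increment _ _ _ (fun=> hazard b) hazard _ _ bh) => x xb.
- exact: derives_linear.
- exact: derives_cumhaz.
- by case/andP: xb => + _; exact: hazard_homo.
Qed.

Lemma cumhaz_right_le b h : 0 < b -> 0 <= h ->
  cumhaz (b + h) - cumhaz b <= (b + b^-1) * h + h ^+ 2 / 2.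
Proof.
move=> b0 h0; have bh : b <= b + h by rewrite lerDl.
set G := fun y : R => b^-1 * y + y ^+ 2 / 2.
have -> : (b + b^-1) * h + h ^+ 2 / 2 = G (b + h) - G b.
  by rewrite /G; field; rewrite gt_eqF.
apply: (@derive_le_increment _ _ _ hazard (fun x => b^-1 + x) _ _ bh) => x xb.
- exact: derives_cumhaz.
- exact: derives_quadratic.
- case/andP: xb => bx _; have x0 := lt_le_trans b0 bx.
  by apply: le_trans (hazard_le x0) _; rewrite addrC lerD2r lef_pV2.
Qed.

Lemma cumhaz_left_le b h : 0 <= h ->
  cumhaz b - cumhaz (b - h) <= hazard b * h.
Proof.
move=> h0; have bh : b - h <= b by rewrite gerBl.
have -> : hazard b * h = hazard b * b - hazard b * (b - h) by ring.
apply: (@derive_le_increment _ _ _ hazard (fun=> hazard b) _ _ bh) => x xb.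
- exact: derives_cumhaz.
- exact: derives_linear.
- by case/andP: xb => _; exact: hazard_homo.
Qed.

Lemma cumhaz_left_ge b h : 0 <= h ->
  hazard b * h - h ^+ 2 / 2 <= cumhaz b - cumhaz (b - h).
Proof.
move=> h0; have bh : b - h <= b by rewrite gerBl.
set G := fun y : R => (hazard b - b) * y + y ^+ 2 / 2.
have -> : hazard b * h - h ^+ 2 / 2 = G b - G (b - h) by rewrite /G; field.
apply: (@derive_le_increment _ _ _ (fun x =>
  hazard b - b + x) hazard _ _ bh) => x xb.
- exact: derives_quadratic.
- exact: derives_cumhaz.
- by case/andP: xb => _ /hazard_sub_homo; lra.
Qed.

End Hazard.

(** * Numerical bounds for pi, e, ln 2 and Q *)

Section Numerics.
Context {R : realType}.
Implicit Types x t : R.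

Lemma derives_monomial c n x :
  derives (fun y : R => c * y ^+ n) x (c * (n%:R * x ^+ n.-1)).
Proof.
apply: derives_eq.
  apply: derives_mul; first exact: derives_const.
  by apply: derives_pow; exact: derives_id.
by rewrite /= mulr0 addr0 mulr1.
Qed.

(** With this second-order bound, the eighth power of e^(1/8) already gives
e >= 27/10; the bound 1 + x <= e^x would require a power above 70. *)
Lemma expR_ge_quadratic x : 0 <= x -> 1 + x + x ^+ 2 / 2 <= expR x.
Proof.
move=> x0.
pose F (y : R) := 1 * y + y ^+ 2 / 2.
have : F x - F 0 <= expR x - expR 0.
  apply: (@derive_le_increment _ _ _ (fun y => 1 + y) expR _ _ x0) => y _.
  - exact: derives_quadratic.
  - exact: derives_expR.
  - exact: expR_ge1Dx.
by rewrite /F expR0; lra.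
Qed.

Lemma sin_le_id x : 0 <= x -> sin x <= x.
Proof.
move=> x0.
have : sin x - sin 0 <= x - 0.
  apply: (@derive_le_increment _ _ _ cos (fun=> 1) _ _ x0) => y _.
  - by apply/derivesP; exact: is_derive_sin.
  - exact: derives_id.
  - exact: cos_le1.
by rewrite sin0 !subr0.
Qed.

Lemma cos_ge_quadratic x : 0 <= x -> 1 - x ^+ 2 / 2 <= cos x.
Proof.
move=> x0; pose F (y : R) := - (2^-1 * y ^+ 2).
have : F x - F 0 <= cos x - cos 0.
  apply: (@derive_le_increment _ _ _ (fun y => - (2^-1 * (2 * y ^+ 1)))
    (fun y => - sin y) _ _ x0) => y /andP[y0 _].
  - by apply: derives_opp; exact: derives_monomial.
  - by apply/derivesP; exact: is_derive_cos.
  - by have := sin_le_id y0; lra.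
by rewrite /F cos0; lra.
Qed.

Lemma sin_ge_cubic x : 0 <= x -> x - x ^+ 3 / 6 <= sin x.
Proof.
move=> x0; pose F (y : R) := y - 6^-1 * y ^+ 3.
have : F x - F 0 <= sin x - sin 0.
  apply: (@derive_le_increment _ _ _ (fun y =>
    1 - 6^-1 * (3 * y ^+ 2)) cos _ _ x0)
    => y /andP[y0 _].
  - apply: derives_add; first exact: derives_id.
    by apply: derives_opp; exact: derives_monomial.
  - by apply/derivesP; exact: is_derive_sin.
  - by have := cos_ge_quadratic y0; lra.
by rewrite /F sin0; lra.
Qed.

(** Successive integration of cos <= 1 through the three previous lemmas. *)
Lemma cos_le_quartic x : 0 <= x -> cos x <= 1 - x ^+ 2 / 2 + x ^+ 4 / 24.
Proof.
move=> x0; pose F (y : R) := - (2^-1 * y ^+ 2) + 24^-1 * y ^+ 4.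
have : cos x - cos 0 <= F x - F 0.
  apply: (@derive_le_increment _ _ _ (fun y => - sin y)
    (fun y => - (2^-1 * (2 * y ^+ 1)) + 24^-1 * (4 * y ^+ 3)) _ _ x0)
    => y /andP[y0 _].
  - by apply/derivesP; exact: is_derive_cos.
  - apply: derives_add; last exact: derives_monomial.
    by apply: derives_opp; exact: derives_monomial.
  - by have := sin_ge_cubic y0; lra.
by rewrite /F cos0; lra.
Qed.

(** The quartic Taylor bound shows that the cosine is already negative at
8/5, which therefore exceeds its first zero pi / 2. *)
Lemma pi_le_16_5 : (pi : R) <= 16 / 5.
Proof.
suff : (pi : R) / 2 <= 8 / 5 by lra.
rewrite leNgt; apply/negP => h.
have c0 : 0 < cos (8 / 5 : R) by apply: cos_gt0_pihalf; apply/andP;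
  split => //; lra.
have := @cos_le_quartic (8 / 5) _;
  suff : ~~ (cos (8 / 5 : R) <= 1 - (8 / 5) ^+ 2 / 2 + (8 / 5) ^+ 4 / 24).
  by move=> /negP k /(_ ltac:(lra)).
by rewrite -ltNge; lra.
Qed.

Lemma pow_ge n (x y z : R) : 0 <= x -> x <= y -> z <= x ^+ n -> z <= y ^+ n.
Proof.
by move=> x0 xy; move/le_trans; apply; rewrite lerXn2r// nnegrE// (le_trans x0).
Qed.

Lemma expR1_ge : 27 / 10 <= expR (1 : R).
Proof.
have -> : 1 = 8%:R * 8^-1 :> R by lra.
rewrite expRM_natl.
have := @expR_ge_quadratic 8^-1 ltac:(lra) => h.
apply: (@pow_ge _ (453 / 400)); lra.
Qed.

Lemma expR1_le3 : expR (1 : R) <= 3.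
Proof.
have -> : 1 = - (6%:R * (- 6^-1)) :> R by lra.
rewrite expRN expRM_natl -[leRHS]invrK lef_pV2 ?posrE ?exprn_gt0 ?expR_gt0//.
apply: (@pow_ge _ (5 / 6)); try lra.
have := @expR_ge1Dx R (- 6^-1); lra.
Qed.

Lemma ln2_le : ln (2 : R) <= 7 / 10.
Proof.
rewrite -ler_expR lnK ?posrE//.
have -> : 7 / 10 = 4%:R * (7 / 40) :> R by lra.
rewrite expRM_natl.
have h := @expR_ge_quadratic (7 / 40) ltac:(lra).
apply: (@pow_ge _ (119 / 100)); lra.
Qed.

(** The square of 253/100 is just above 2 * (16/5), hence above 2 pi. *)
Lemma phi_ge t : 100 / 253 * expR (- (t ^+ 2 / 2)) <= phi t.
Proof.
rewrite phiE ler_pM2r ?expR_gt0// -[leLHS]invf_div lef_pV2 ?posrE; first last.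
- by rewrite sqrtr_gt0 mulr_gt0// pi_gt0.
- lra.
rewrite -[leRHS]ger0_norm; last lra.
rewrite -sqrtr_sqr ler_wsqrtr//; have := pi_le_16_5; lra.
Qed.

Lemma phi_ge_pow t k : t ^+ 2 <= 2 * k.+1%:R ->
  100 / 253 * (1 - t ^+ 2 / (2 * k.+1%:R)) ^+ k.+1 <= phi t.
Proof.
move=> tk; apply: le_trans (phi_ge t); rewrite ler_pM2l; last lra.
have k0 : 0 < k.+1%:R :> R by rewrite ltr0n.
have -> : - (t ^+ 2 / 2) = k.+1%:R * (- (t ^+ 2 / (2 * k.+1%:R))).
  by field; rewrite gt_eqF.
rewrite expRM_natl; apply: pow_ge; [|exact: expR_ge1Dx|exact: lexx].
by rewrite subr_ge0 ler_pdivrMr ?mul1r ?mulr_gt0.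
Qed.

(** [phi_Q_quadratic] bounds Q t below by the positive root of a quadratic
polynomial; a lower bound p of phi t and a sign test at q certify that the root
is at least q. *)
Lemma Q_ge_of_phi_ge t p q : 0 <= p <= phi t -> 0 <= t -> 0 < q ->
  q ^+ 2 + t * p * q <= p ^+ 2 -> q <= Q t.
Proof.
move=> /andP[p0 pphi] t0 q0 qp; rewrite leNgt; apply/negP => Qq.
have := phi_Q_quadratic t; apply/negP; rewrite -ltNge.
have Q0 := Q_gt0 t; have f0 := phi_gt0 t.
have h1 : t * Q t <= t * q by rewrite ler_wpM2l// ltW.
have h2 : t * q <= p.
  case: (leP (t * q) p) => // h.
  have : p * p < t * q * p + q ^+ 2.
    by apply: (@le_lt_trans _ _ (t * q * p));
      [rewrite ler_wpM2r// ltW|rewrite ltrDl exprn_gt0].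
  by rewrite -expr2; lra.
have h3 : Q t ^+ 2 < q ^+ 2 by rewrite ltrXn2r ?nnegrE ?ltW.
have h4 : p * (p - t * q) <= phi t * (phi t - t * q).
  by rewrite ler_pM// ?subr_ge0// lerD2r.
have h5 : phi t * (t * Q t) <= phi t * (t * q) by rewrite ler_pM2l.
lra.
Qed.

(** The three points are chosen just below the quantiles of orders 1 - 1/5,
1 - 1/8 and 1 - 1/16. *)
Lemma Q_3_4 : 5^-1 <= Q (3 / 4 : R).
Proof.
apply: (@Q_ge_of_phi_ge _ (100 / 253 * (1 - (3 / 4) ^+ 2 / (2 * 2)) ^+ 2));
  try lra.
apply/andP; split; first lra.
by apply: (@phi_ge_pow _ 1); lra.
Qed.

Lemma Q_1 : 8^-1 <= Q (1 : R).
Proof.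
apply: (@Q_ge_of_phi_ge _ (100 / 253 * (1 - 1 ^+ 2 / (2 * 2)) ^+ 2)); try lra.
apply/andP; split; first lra.
by apply: (@phi_ge_pow _ 1); lra.
Qed.

Lemma Q_3_2 : 16^-1 <= Q (3 / 2 : R).
Proof.
have h : 317 / 1000 <= (247 / 256) ^+ (2 * (2 * (2 * (2 * 2)))) :> R.
  (* repeated squaring with rounding keeps the rationals small *)
  rewrite !exprM.
  apply: (@pow_ge 2 (5637 / 10000)); [lra| |lra].
  apply: (@pow_ge 2 (7508 / 10000)); [lra| |lra].
  apply: (@pow_ge 2 (8665 / 10000)); [lra| |lra].
  apply: (@pow_ge 2 (9309 / 10000)); lra.
apply: (@Q_ge_of_phi_ge _ (100 / 253 * (317 / 1000))); try lra.
apply/andP; split; first lra.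
apply: le_trans (@phi_ge_pow _ 31 _); last lra.
have -> : 1 - (3 / 2) ^+ 2 / (2 * 32) = 247 / 256 :> R by lra.
by rewrite ler_pM2l//; lra.
Qed.

End Numerics.

(** * Exponential inequalities *)

Section Exponential.
Context {R : realType}.
Implicit Types q v x y z : R.

Lemma mul_expRN_le z : z * expR (- z) <= 10 / 27.
Proof.
have h : z <= expR (z - 1) by have := expR_ge1Dx (z - 1); lra.
have e1 := @expR1_ge R.
apply: (@le_trans _ _ (expR (z - 1) * expR (- z)));
  first by rewrite ler_pM2r ?expR_gt0.
by rewrite -expRD addrAC subrr add0r expRN -[leRHS]invf_div lef_pV2 ?posrE
  ?expR_gt0.
Qed.

(** The maximum of z^k e^-z is (k / e)^k, and 1 / e <= 10/27. *)
Lemma exprn_expRN_le z k : 0 <= z ->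
  z ^+ k.+1 * expR (- z) <= (k.+1%:R * (10 / 27)) ^+ k.+1.
Proof.
move=> z0; have k0 : 0 < k.+1%:R :> R by rewrite ltr0n.
have -> : - z = k.+1%:R * (- (z / k.+1%:R)) by field; rewrite gt_eqF.
rewrite expRM_natl -exprMn lerXn2r ?nnegrE ?mulr_ge0 ?expR_ge0 ?(ltW k0)//.
have := mul_expRN_le (z / k.+1%:R).
by rewrite mulrAC ler_pdivrMr// (mulrC k.+1%:R).
Qed.

Lemma bernoulli_ineq (u : R) n : 0 <= u <= 1 -> 1 - n%:R * u <= (1 - u) ^+ n.
Proof.
move=> /andP[u0 u1]; elim: n => [|n ih]; first by rewrite expr0 mul0r subr0.
rewrite exprS -natr1.
have h1 : (1 - u) * (1 - n%:R * u) <= (1 - u) * (1 - u) ^+ n.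
  by rewrite ler_wpM2l// subr_ge0.
apply: le_trans h1; have h2 : 0 <= n%:R * (u * u) by rewrite !mulr_ge0.
lra.
Qed.

Lemma pow_le_expRN q n : (0 < n)%N -> q <= n%:R ->
  (1 - q / n%:R) ^+ n <= expR (- q).
Proof.
move=> n0 qn; have n1 : 0 < n%:R :> R by rewrite ltr0n.
have -> : - q = n%:R * (- (q / n%:R)) by field; rewrite gt_eqF.
rewrite expRM_natl lerXn2r ?nnegrE ?expR_ge0 ?expR_ge1Dx//.
by rewrite subr_ge0 ler_pdivrMr// mul1r.
Qed.

(** With u = q / n one has (1 - u) e^u >= 1 - u^2, so the relative error is at
most n u^2 by Bernoulli's inequality, and n u^2 e^-q = q^2 e^-q / n. *)
Lemma expRN_le_pow q n : (0 < n)%N -> 0 <= q <= n%:R ->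
  expR (- q) <= (1 - q / n%:R) ^+ n + 4 / 7 / n%:R.
Proof.
move=> n0 /andP[q0 qn]; have n1 : 0 < n%:R :> R by rewrite ltr0n.
set u := q / n%:R.
have u01 : 0 <= u <= 1.
  by rewrite divr_ge0 ?(ltW n1)//= ler_pdivrMr// mul1r.
have qE : q = n%:R * u by rewrite /u; field; rewrite gt_eqF.
have u0 : 0 <= u by case/andP: u01.
have u1 : u <= 1 by case/andP: u01.
have uu : 0 <= u ^+ 2 <= 1.
  by rewrite sqr_ge0 -(expr1n _ 2) lerXn2r ?nnegrE.
have step : (1 - u ^+ 2) ^+ n * expR (- q) <= (1 - u) ^+ n.
  have -> : 1 - u ^+ 2 = (1 - u) * (1 + u) by ring.
  have h : ((1 + u) * expR (- u)) ^+ n <= 1.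
    rewrite exprn_ile1 ?mulr_ge0 ?expR_ge0 ?addr_ge0//.
    by rewrite expRN ler_pdivrMr ?expR_gt0// mul1r expR_ge1Dx.
  rewrite exprMn (_ : - q = n%:R * - u) ?expRM_natl; last by rewrite qE mulrN.
  rewrite -mulrA -exprMn ler_piMr//.
  by rewrite exprn_ge0// subr_ge0.
have b := bernoulli_ineq n uu.
have e0 := expR_gt0 (- q).
have b' : (1 - n%:R * u ^+ 2) * expR (- q) <= (1 - u ^+ 2) ^+ n * expR (- q).
  by rewrite ler_pM2r.
have k := @exprn_expRN_le q 1 q0.
have k' : n%:R * u ^+ 2 * expR (- q) <= 4 / 7 / n%:R.
  rewrite ler_pdivlMr//.
  have -> : n%:R * u ^+ 2 * expR (- q) * n%:R = q ^+ 2 * expR (- q)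
    by rewrite qE; ring.
  by apply: le_trans k _; lra.
lra.
Qed.

(** Here e^-q - e^-y <= e^-q (y - q), and y - q <= y (1 - e^-v) <= y v. *)
Lemma gumbel_gap q y v : 0 <= q -> 0 <= y -> 0 <= v -> y * expR (- v) <= q ->
  expR (- q) - expR (- y) <= y * v.
Proof.
move=> q0 y0 v0 yq.
have e0 := expR_gt0 (- q).
have e1 : expR (- q) <= 1 by rewrite expR_le1 oppr_le0.
have h1 : expR (- q) * (1 + (q - y)) <= expR (- y).
  have -> : expR (- y) = expR (- q) * expR (q - y) by rewrite -expRD;
    congr expR; ring.
  by rewrite ler_pM2l// expR_ge1Dx.
have h2 : y * (1 - v) <= y * expR (- v) by rewrite ler_wpM2l// expR_ge1Dx.
have yv : 0 <= y * v by rewrite mulr_ge0.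
have h3 : expR (- q) * (y - q) <= expR (- q) * (y * v) by rewrite ler_pM2l//;
  lra.
have h4 : expR (- q) * (y * v) <= y * v by rewrite ler_piMl.
lra.
Qed.

(** The function v |-> exp (- q e^v) has slope - z e^-z at z = q e^v, and
z e^-z is nonincreasing for z >= 1; so the slope at v = 0 is the steepest. *)
Lemma gumbel_gap_log q v : 1 <= q -> 0 <= v ->
  expR (- q) - expR (- (q * expR v)) <= v * (q * expR (- q)).
Proof.
move=> q1 v0.
pose F (t : R) := - expR (- (q * expR t)).
pose G (t : R) := q * expR (- q) * t.
have : F v - F 0 <= G v - G 0.
  apply: (@derive_le_increment _ _ _ (fun t =>
    q * expR t * expR (- (q * expR t)))
    (fun=> q * expR (- q)) _ _ v0) => t /andP[t0 _].
  - apply: derives_eq.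
      apply: derives_opp; apply: derives_chain; last exact: derives_expR.
      apply: derives_opp; apply: derives_mul; first exact: derives_const.
      exact: derives_expR.
    by rewrite /=; ring.
  - exact: derives_linear.
  - rewrite -mulrA ler_pM2l ?(lt_le_trans _ q1)// -expRD ler_expR.
    have et := expR_ge1Dx t.
    have : t <= q * (expR t - 1).
      have h1 : 0 <= (q - 1) * (expR t - 1) by rewrite mulr_ge0//; lra.
      lra.
    lra.
by rewrite /F /G expR0 mulr1 mulr0 subr0; lra.
Qed.

End Exponential.

(** * The normalised tail and the deviation from the Gumbel law *)

Section Normalisation.
Context {R : realType}.
Implicit Types b x s : R.

Definition scale b : R := b / (1 + b ^+ 2).

(** How much the slope of - ln (tail_ratio b x) at x = 0, which is
hazard b * scale b, may fall short of 1. *)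
Definition deficit b : R := 2 / ((b ^+ 2 + 1) * (b ^+ 2 + 2)).

Lemma scale_gt0 b : 0 < b -> 0 < scale b.
Proof. by move=> b0; rewrite divr_gt0// addr_gt0// exprn_gt0. Qed.

(** Both bounds are exact computations: 1 is the upper bound b + 1 / b of
[hazard_le] times the scale, and 1 - deficit the lower bound of [hazard_ge]
times the scale. *)
Lemma hazard_scale b : 0 < b -> 1 - deficit b <= hazard b * scale b <= 1.
Proof.
move=> b0; have B0 : 0 < b ^+ 2 by rewrite exprn_gt0.
have h1 : 0 < b ^+ 2 + 1 by rewrite addr_gt0.
have h2 : 0 < b ^+ 2 + 2 by rewrite addr_gt0.
have h3 : 0 < 1 + b ^+ 2 by rewrite addr_gt0.
apply/andP; split.
  have := hazard_ge b0; rewrite -(ler_pM2r (scale_gt0 b0)); apply: le_trans.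
  rewrite le_eqVlt; apply/orP; left; apply/eqP; rewrite /scale /deficit.
  by field; rewrite !gt_eqF.
have := hazard_le b0; rewrite -(ler_pM2r (scale_gt0 b0)) => /le_trans; apply.
rewrite le_eqVlt; apply/orP; left; apply/eqP; rewrite /scale.
by field; rewrite !gt_eqF.
Qed.

(** Equal to n Q (a x + b) when Q b = 1 / n; this is the expected number of
exceedances of the level a x + b, to be compared with e^-x. *)
Definition tail_ratio b x : R := Q (scale b * x + b) / Q b.

Lemma tail_ratioE b x :
  tail_ratio b x = expR (- (cumhaz (b + scale b * x) - cumhaz b)).
Proof.
by rewrite /cumhaz opprD !opprK expRD expRN !lnK ?posrE ?Q_gt0// addrC.
Qed.

Lemma tail_ratio_gt0 b x : 0 < tail_ratio b x.
Proof. by rewrite divr_gt0 ?Q_gt0. Qed.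

Lemma tail_ratio_right b x : 0 < b -> 0 <= x ->
  expR (- (x + scale b ^+ 2 * x ^+ 2 / 2)) <= tail_ratio b x
    <= expR (- ((1 - deficit b) * x)).
Proof.
move=> b0 x0; rewrite tail_ratioE !ler_expR !lerN2.
have ax0 : 0 <= scale b * x by rewrite mulr_ge0// ltW// scale_gt0.
have /andP[hz _] := hazard_scale b0.
apply/andP; split.
  apply: le_trans (cumhaz_right_le b0 ax0) _.
  have -> : (b + b^-1) * (scale b * x) = x.
    have x1 : 0 < 1 + b ^+ 2 by rewrite addr_gt0// exprn_gt0.
    by rewrite /scale; field; rewrite !gt_eqF.
  by rewrite (exprMn 2 (scale b)).
apply: le_trans (cumhaz_right_ge b ax0); rewrite mulrA ler_wpM2r//.
Qed.

Lemma tail_ratio_left b s : 0 < b -> 0 <= s ->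
  expR ((1 - deficit b) * s - scale b ^+ 2 * s ^+ 2 / 2) <= tail_ratio b (- s)
    <= expR s.
Proof.
move=> b0 s0; rewrite tail_ratioE !ler_expR mulrN opprB.
have as0 : 0 <= scale b * s by rewrite mulr_ge0// ltW// scale_gt0.
have /andP[hz hz1] := hazard_scale b0.
apply/andP; split.
  apply: le_trans (cumhaz_left_ge b as0);
    rewrite (exprMn 2 (scale b)) (mulrA (hazard b)) lerD2r.
  by rewrite ler_wpM2r.
apply: le_trans (cumhaz_left_le b as0) _.
by rewrite mulrA ler_piMl.
Qed.

End Normalisation.

Section Deviation.
Context {R : realType}.
Context (b : R) (n : nat).
Context (b0 : 0 < b) (n0 : (0 < n)%N) (Qb : Q b = n%:R^-1).

Let F x : R := Phi (scale b * x + b) ^+ n.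
Let q x : R := tail_ratio b x.

Let n1 : 0 < n%:R :> R. Proof. by rewrite ltr0n. Qed.

Let q_le_n x : 0 <= q x <= n%:R.
Proof.
by rewrite ltW ?tail_ratio_gt0//= /q /tail_ratio Qb invrK ler_piMl ?ler0n//
  Q_le1.
Qed.

Let FE x : F x = (1 - q x / n%:R) ^+ n.
Proof.
congr (_ ^+ n); rewrite /q /tail_ratio Qb invrK mulfK ?gt_eqF//.
by rewrite /Q; ring.
Qed.

Lemma max_le_expRN x : F x <= expR (- q x).
Proof. by rewrite FE; apply: pow_le_expRN => //; case/andP: (q_le_n x). Qed.

Lemma max_ge_expRN x : expR (- q x) - 4 / 7 / n%:R <= F x.
Proof. by rewrite FE lerBlDr; apply: expRN_le_pow. Qed.

Lemma max_ndecr x y : x <= y -> F x <= F y.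
Proof.
move=> xy; rewrite lerXn2r ?nnegrE ?Phi_ge0//.
rewrite -lerN2 -(lerD2l 1); apply: Q_le.
by rewrite lerD2r ler_pM2l// scale_gt0.
Qed.

(** To the right of 0 the two signs are separate errors: the
distribution function of the maximum exceeds Lambda by at most the quadratic
term of [tail_ratio_right], and falls short of it by at most the effect of the
slope deficit plus the error of [expRN_le_pow]. *)
Lemma deviation_right x M : 0 <= x -> deficit b < 1 ->
  2 / 7 * scale b ^+ 2 <= M ->
  deficit b / (1 - deficit b) * (10 / 27) + 4 / 7 / n%:R <= M ->
  `|F x - Lambda x| <= M.
Proof.
move=> x0 d1 M1 M2.
have /andP[qlo qhi] := tail_ratio_right b0 x0.
have d0 : 0 <= deficit b.
  by rewrite divr_ge0// mulr_ge0// addr_ge0// sqr_ge0.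
rewrite ler_norml; apply/andP; split.
  set d := deficit b in d0 d1 M2 qhi *.
  have lo := max_ge_expRN x.
  set z := expR (- ((1 - d) * x)) in qhi.
  have h1 : expR (- z) <= expR (- q x) by rewrite ler_expR lerN2.
  set y := expR (- x).
  have y0 : 0 < y by exact: expR_gt0.
  have h2 : expR (- y) * (1 - (z - y)) <= expR (- z).
    have -> : expR (- z) = expR (- y) * expR (- (z - y)).
      by rewrite -expRD; congr expR; ring.
    by rewrite ler_pM2l ?expR_gt0// expR_ge1Dx.
  have ey : expR (- y) <= 1 by rewrite expR_le1 oppr_le0 ltW.
  have zy : y <= z by rewrite ler_expR lerN2 ler_piMl//; lra.
  have h3 : expR (- y) * (z - y) <= z - y by rewrite ler_piMl ?subr_ge0.
  have h4 : z - y <= z * (d * x).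
    have -> : y = z * expR (- (d * x)) by rewrite -expRD; congr expR; ring.
    have := expR_ge1Dx (- (d * x));
      rewrite -(ler_pM2l (expR_gt0 (- ((1 - d) * x)))) -/z.
    lra.
  have h5 : z * (d * x) <= d / (1 - d) * (10 / 27).
    have -> : z * (d * x) = d / (1 - d) * ((1 - d) * x * z).
      by field; rewrite subr_eq0 gt_eqF.
    have dd : 0 <= d / (1 - d) by apply: divr_ge0 => //; rewrite subr_ge0 ltW.
    by apply: ler_wpM2l => //; exact: mul_expRN_le.
  rewrite /Lambda -/y; lra.
have v0 : 0 <= scale b ^+ 2 * x ^+ 2 / 2.
  by rewrite divr_ge0// mulr_ge0// sqr_ge0.
have h := @gumbel_gap _ (q x) (expR (- x)) (scale b ^+ 2 * x ^+ 2 / 2) _ _ v0.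
have {h} : expR (- q x) - expR (- expR (- x)) <=
  expR (- x) * (scale b ^+ 2 * x ^+ 2 / 2).
  apply: h; first exact/ltW/tail_ratio_gt0.
    exact: expR_ge0.
  by rewrite -expRD -opprD.
have k := @exprn_expRN_le _ x 1 x0.
have -> : expR (- x) * (scale b ^+ 2 * x ^+ 2 / 2) = scale b ^+ 2 / 2 * (x ^+
  2 * expR (- x)).
  by ring.
have k' : x ^+ 2 * expR (- x) <= 4 / 7 by apply: le_trans k _; lra.
have k2 : scale b ^+ 2 / 2 * (x ^+ 2 * expR (- x)) <=
  scale b ^+ 2 / 2 * (4 / 7).
  by rewrite ler_wpM2l// divr_ge0// sqr_ge0.
have := max_le_expRN x; rewrite /Lambda; lra.
Qed.

(** To the left of 0 one has q (- s) <= e^s, so only the error of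
[expRN_le_pow] can bring the distribution function of the maximum below
  Lambda. *)
Lemma deviation_left_lower s : 0 <= s ->
  - (4 / 7 / n%:R) <= F (- s) - Lambda (- s).
Proof.
move=> s0; have /andP[_ qhi] := tail_ratio_left b0 s0.
have := max_ge_expRN (- s).
have : expR (- expR s) <= expR (- q (- s)) by rewrite ler_expR lerN2.
rewrite /Lambda opprK; lra.
Qed.

(** Useful as long as the lower bound of ln (q (- s)) in [tail_ratio_left] is
increasing in s: beyond that point the quadratic term makes it void. *)
Lemma deviation_left_near s : 0 <= s -> 1 <= q (- s) ->
  F (- s) - Lambda (- s) <=
    (deficit b * s + scale b ^+ 2 * s ^+ 2 / 2) * (q (- s) * expR (- q (- s))).
Proof.
move=> s0 q1; have /andP[qlo qhi] := tail_ratio_left b0 s0.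
have q0 : 0 < q (- s) by exact: tail_ratio_gt0.
set v := s - ln (q (- s)).
have ev : q (- s) * expR v = expR s.
  by rewrite /v expRD expRN lnK ?posrE// mulrC mulfVK// gt_eqF.
have v0 : 0 <= v.
  by rewrite subr_ge0 -ler_expR lnK ?posrE.
have := gumbel_gap_log q1 v0; rewrite ev.
have := max_le_expRN (- s).
have vle : v <= deficit b * s + scale b ^+ 2 * s ^+ 2 / 2.
  have : (1 - deficit b) * s - scale b ^+ 2 * s ^+ 2 / 2 <= ln (q (- s)).
    by rewrite -ler_expR lnK ?posrE.
  rewrite /v; lra.
have : v * (q (- s) * expR (- q (- s))) <=
  (deficit b * s + scale b ^+ 2 * s ^+ 2 / 2) * (q (- s) * expR (- q (- s))).
  by rewrite ler_wpM2r// mulr_ge0 ?expR_ge0// ltW.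
rewrite /Lambda opprK; lra.
Qed.

(** Complements [deviation_left_near]: the distribution function at - s is at
most its value at - s1, which is small when q (- s1) is large. *)
Lemma deviation_left_far s1 s : s1 <= s ->
  F (- s) - Lambda (- s) <= expR (- q (- s1)).
Proof.
move=> ss; have := max_le_expRN (- s1).
have : F (- s) <= F (- s1) by apply: max_ndecr; rewrite lerN2.
have := expR_ge0 (- expR s); rewrite /Lambda opprK; lra.
Qed.

End Deviation.

(** * Explicit bounds on the deviation *)

Section Bounds.
Context {R : realType}.
Implicit Types b x s : R.

Lemma deficit_le b (c D : R) : 0 <= c <= b ^+ 2 ->
  2 <= D * ((c + 1) * (c + 2)) -> 0 <= D ->
  deficit b <= D.
Proof.
move=> /andP[c0 cb] h D0.
rewrite ler_pdivrMr; last by rewrite mulr_gt0// ltr_wpDl// sqr_ge0.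
apply: le_trans h _; rewrite ler_wpM2l// ler_pM ?lerD2r//; lra.
Qed.

Lemma scale_sqr_le_inv b : scale b ^+ 2 <= (b ^+ 2 + 2)^-1.
Proof.
have h1 : 0 < 1 + b ^+ 2 by rewrite ltr_pwDl// sqr_ge0.
have h2 : 0 < b ^+ 2 + 2 by rewrite ltr_wpDl// sqr_ge0.
rewrite /scale expr_div_n ler_pdivrMr ?exprn_gt0// mulrC ler_pdivlMr//.
lra.
Qed.

Lemma scale_sqr_le b : scale b ^+ 2 <= 4^-1.
Proof.
have h1 : 0 < 1 + b ^+ 2 by rewrite ltr_pwDl// sqr_ge0.
rewrite /scale expr_div_n ler_pdivrMr ?exprn_gt0//.
have := sqr_ge0 (b ^+ 2 - 1); lra.
Qed.

(** For moderate b the crude bounds deficit <= 1/2 and scale^2 <= 1/4 are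
enough, with the left half-line split at s = 1. *)
Lemma deviation_small b n x M : 0 < b -> (0 < n)%N -> Q b = n%:R^-1 ->
  9 / 16 <= b ^+ 2 ->
  deficit b / (1 - deficit b) * (10 / 27) + 4 / 7 / n%:R <= M ->
    31 / 100 <= M ->
  `|Phi (scale b * x + b) ^+ n - Lambda x| <= M.
Proof.
move=> b0 n0 Qb b2 M1 M2.
have d1 : deficit b <= 2^-1 by apply: (@deficit_le _ (9 / 16)); lra.
have d0 : 0 <= deficit b.
  by rewrite divr_ge0// mulr_ge0// addr_ge0// sqr_ge0.
have a1 := scale_sqr_le b.
have a0 := sqr_ge0 (scale b).
have [x0|x0] := leP 0 x; first by apply: deviation_right => //; lra.
rewrite -[x]opprK; set s := - x.
have s0 : 0 <= s by rewrite oppr_ge0 ltW.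
have q0 := tail_ratio_gt0 b (- s).
rewrite ler_norml; apply/andP; split.
  apply: le_trans (deviation_left_lower b0 n0 Qb s0); rewrite lerN2.
  apply: le_trans M1; rewrite lerDr mulr_ge0// divr_ge0//; lra.
have [s1|s1] := leP s 1.
  have ss : s ^+ 2 <= s by rewrite expr2 ler_piMr.
  have s2 := sqr_ge0 s.
  have as2 : scale b ^+ 2 * s ^+ 2 <= 4^-1 * s by rewrite ler_pM.
  have ds : deficit b * s <= 2^-1 * s by rewrite ler_wpM2r.
  have q1 : 1 <= tail_ratio b (- s).
    have /andP[+ _] := tail_ratio_left b0 s0.
    apply: le_trans; rewrite -[leLHS]expR0 ler_expR; lra.
  apply: le_trans (deviation_left_near b0 n0 Qb s0 q1) _.
  apply: (@le_trans _ _ (5 / 8 * (10 / 27))); last lra.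
  apply: ler_pM.
  - have := mulr_ge0 d0 s0; have := mulr_ge0 a0 s2; lra.
  - by rewrite mulr_ge0 ?expR_ge0// ltW.
  - lra.
  - exact: mul_expRN_le.
apply: le_trans (deviation_left_far b0 n0 Qb (ltW s1)) _.
have /andP[qlo _] := tail_ratio_left b0 (@ler01 R).
have qge : 36 / 25 <= tail_ratio b (- 1).
  apply: le_trans qlo.
  apply: (@le_trans _ _ (expR (3 / 8))).
    have := @expR_ge_quadratic R (3 / 8); lra.
  rewrite ler_expR; lra.
apply: (@le_trans _ _ (expR (- (36 / 25)))); first by rewrite ler_expR lerN2.
rewrite expRN -[M]invrK lef_pV2 ?posrE ?expR_gt0 ?invr_gt0//; last lra.
apply: (@le_trans _ _ (100 / 31)).
  rewrite -[leRHS]invf_div lef_pV2 ?posrE//; lra.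
have := @expR_ge_quadratic R (36 / 25); lra.
Qed.

(** On the left half-line, the split point s1 is half of the point where the
lower bound of ln q in [tail_ratio_left] is maximal. Up to s1 one has
s <= (8/5) ln q and ln q <= q / e, so the error of [deviation_left_near] is at
most b^-2 times a combination of q^2 e^-q and q^3 e^-q. At s1 itself
ln q >= (b^2 + 2) / 4, so that e^-q is much smaller than b^-2. *)
Lemma deviation_large b n x : 0 < b -> (0 < n)%N -> Q b = n%:R^-1 ->
  9 / 4 <= b ^+ 2 ->
  `|Phi (scale b * x + b) ^+ n - Lambda x| <= 3 / 5 / b ^+ 2 + 4 / 7 / n%:R.
Proof.
move=> b0 n0 Qb b2.
set B := b ^+ 2 in b2 *.
have B0 : 0 < B by lra.
have n1 : 0 < n%:R :> R by rewrite ltr0n.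
have d0 : 0 < deficit b.
  by rewrite divr_gt0// mulr_gt0// addr_gt0.
have d1 : deficit b <= 4 / 27 by apply: (@deficit_le _ (9 / 4)); rewrite -/B;
  lra.
have dB : deficit b <= 3^-1 / B.
  apply: (@deficit_le _ B); rewrite -/B ?lexx ?(ltW B0)//;
    last by rewrite divr_ge0// ltW.
  rewrite mulrAC ler_pdivlMr//.
  have : 0 <= (B - 1) * (B - 2) by rewrite mulr_ge0//; lra.
  lra.
have aB := scale_sqr_le_inv b; rewrite -/B in aB.
have a0 : 0 < scale b ^+ 2 by rewrite exprn_gt0// scale_gt0.
set al := scale b ^+ 2 in aB a0.
have aB1 : al <= B^-1.
  by apply: le_trans aB _; rewrite lef_pV2 ?posrE//; lra.
have iB : 0 < B^-1 by rewrite invr_gt0.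
have in0 : 0 < 4 / 7 / n%:R :> R by rewrite !divr_gt0.
have [x0|x0] := leP 0 x.
  apply: deviation_right => //; first lra.
    rewrite -/al; lra.
  rewrite lerD2r.
  apply: (@le_trans _ _ (3^-1 / B * (27 / 23) * (10 / 27))); last lra.
  rewrite ler_pM2r; last lra.
  apply: ler_pM => //; first exact: ltW.
    rewrite invr_ge0; lra.
  rewrite -[leRHS]invf_div lef_pV2 ?posrE; lra.
rewrite -[x]opprK; set s := - x.
have s0 : 0 <= s by rewrite oppr_ge0 ltW.
rewrite ler_norml; apply/andP; split.
  apply: le_trans (deviation_left_lower b0 n0 Qb s0); rewrite lerN2 lerDr.
  by rewrite divr_ge0// ltW.
set s1 := (1 - deficit b) / (2 * al).
have s10 : 0 <= s1 by apply: divr_ge0; lra.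
have exponent_ge t : 0 <= t <= s1 ->
    3 / 4 * (1 - deficit b) * t <= (1 - deficit b) * t - al * t ^+ 2 / 2.
  move=> /andP[t0 ts]; rewrite /s1 ler_pdivlMr in ts; last by rewrite mulr_gt0.
  have : t * (t * (2 * al)) <= t * (1 - deficit b) by rewrite ler_wpM2l.
  lra.
have [ss|ss] := leP s s1.
  have /andP[qlo _] := tail_ratio_left b0 s0.
  set q := tail_ratio b (- s) in qlo *.
  have es := exponent_ge s; rewrite s0 ss in es; have {}es := es isT.
  have q0 : 0 < q by exact: tail_ratio_gt0.
  (* 3/4 * (1 - deficit) >= 3/4 * 23/27 >= 5/8 *)
  have ls : s <= 8 / 5 * ln q.
    have : (1 - deficit b) * s - al * s ^+ 2 / 2 <= ln q
      by rewrite -ler_expR lnK ?posrE.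
    have : 23 / 27 * s <= (1 - deficit b) * s by rewrite ler_wpM2r//; lra.
    lra.
  have l0 : 0 <= ln q by lra.
  have q1 : 1 <= q by rewrite -expR0 -[q]lnK ?posrE// ler_expR.
  have lq : ln q <= 10 / 27 * q.
    have := expR_ge1Dx (ln q - 1); rewrite expRB lnK ?posrE// => h.
    have : q / expR 1 <= q / (27 / 10).
      rewrite ler_pM2l// lef_pV2 ?posrE ?expR_gt0//; first exact: expR1_ge.
    lra.
  apply: le_trans (deviation_left_near b0 n0 Qb s0 q1) _.
  rewrite -/q -/al.
  (* s <= 8/5 * ln q <= 8/5 * 10/27 * q *)
  set r := 16 / 27 * q.
  have sr : s <= r by rewrite /r; lra.
  have sr2 : s ^+ 2 <= r ^+ 2 by rewrite lerXn2r ?nnegrE//; lra.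
  have e1 : deficit b * s <= 3^-1 / B * r by rewrite ler_pM ?(ltW d0).
  have e2 : al * s ^+ 2 <= B^-1 * r ^+ 2 by rewrite ler_pM ?(ltW a0) ?sqr_ge0.
  have qe0 : 0 <= q * expR (- q) by rewrite mulr_ge0 ?expR_ge0// ltW.
  apply: (@le_trans _ _ ((3^-1 / B * r + B^-1 * r ^+ 2 / 2) * (q * expR (-
    q)))).
    by rewrite ler_wpM2r//; lra.
  have h2 := @exprn_expRN_le _ q 1 (ltW q0).
  have h3 := @exprn_expRN_le _ q 2 (ltW q0).
  have k2 : q ^+ 2 * expR (- q) <= (20 / 27) ^+ 2 by apply: le_trans h2 _; lra.
  have k3 : q ^+ 3 * expR (- q) <= (10 / 9) ^+ 3 by apply: le_trans h3 _; lra.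
  have -> : (3^-1 / B * r + B^-1 * r ^+ 2 / 2) * (q * expR (- q)) =
    B^-1 * (16 / 81 * (q ^+ 2 * expR (- q)) + 128 / 729 * (q ^+ 3 * expR (-
      q))).
    by rewrite /r; field; rewrite gt_eqF.
  have : B^-1 * (16 / 81 * (q ^+ 2 * expR (- q)) + 128 / 729 * (q ^+ 3 * expR
    (- q))) <= B^-1 * (3 / 5).
    by rewrite ler_wpM2l ?(ltW iB)//; lra.
  lra.
apply: le_trans (deviation_left_far b0 n0 Qb (ltW ss)) _.
have /andP[qlo _] := tail_ratio_left b0 s10.
rewrite -/al in qlo; set q := tail_ratio b (- s1) in qlo *.
have q0 : 0 < q by exact: tail_ratio_gt0.
have es := exponent_ge s1; rewrite s10 lexx in es; have {}es := es isT.
have w : (B + 2) / 4 <= 3 / 4 * (1 - deficit b) * s1.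
  have -> : 3 / 4 * (1 - deficit b) * s1 = 3 / 8 * (1 - deficit b) ^+ 2 * al^-1.
    by rewrite /s1; field; rewrite gt_eqF.
  have h1 : B + 2 <= al^-1.
    rewrite -[leLHS]invrK lef_pV2 ?posrE ?invr_gt0//; lra.
  have h2 : 2 / 3 <= (1 - deficit b) ^+ 2.
    have : (23 / 27) ^+ 2 <= (1 - deficit b) ^+ 2
      by rewrite lerXn2r ?nnegrE//; lra.
    lra.
  have : 2 / 3 * (B + 2) <= (1 - deficit b) ^+ 2 * al^-1 by rewrite ler_pM//;
    lra.
  lra.
have qw : 27 / 10 * ((B + 2) / 4) <= q.
  apply: le_trans qlo; apply: le_trans (_ : expR ((B + 2) / 4) <= _);
    last first.
    by rewrite ler_expR; lra.
  have -> : (B + 2) / 4 = 1 + ((B + 2) / 4 - 1) by ring.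
  rewrite expRD; apply: ler_pM; [lra|lra|exact: expR1_ge|].
  exact: expR_ge1Dx.
have := mul_expRN_le q.
have e0 := expR_ge0 (- q).
have : 27 / 10 * ((B + 2) / 4) * expR (- q) <= q * expR (- q)
  by rewrite ler_wpM2r.
move=> h1 h2.
have h3 : expR (- q) * B <= 3 / 5 by lra.
have : expR (- q) <= 3 / 5 / B by rewrite ler_pdivlMr.
lra.
Qed.

End Bounds.

(** * Quantiles of the normal law *)

Section Quantile.
Context {R : realType}.
Implicit Types (t : R) (m n : nat).

(** The default value of [Phi_inv] is never used: the intermediate value
theorem on [3/4, T], with T large, provides a preimage of 1 - 1 / n. *)
Lemma Q_quantile n : (5 <= n)%N -> Q (b_ n : R) = n%:R^-1.
Proof.
move=> n5; have n0 : 0 < n%:R :> R by rewrite ltr0n (leq_trans _ n5).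
suff [x Px] : exists x : R, Phi x = 1 - 1 / n%:R.
  have : Phi (b_ n : R) = 1 - 1 / n%:R
    by exact: (@xgetPex _ 0 [set y : R | Phi y = 1 - 1 / n%:R] (ex_intro _ x
      Px)).
  by rewrite /Q => ->; rewrite opprB addrC subrK div1r.
have n5R : n%:R^-1 <= 5^-1 :> R by rewrite lef_pV2 ?posrE// ler_nat.
near (+oo : set_system R) => T.
have T1 : 3 / 4 <= T by [].
have QT : Q T <= n%:R^-1 by near: T; apply: Q_small; rewrite invr_gt0.
have Q34 := @Q_3_4 R.
have P1 : Phi (3 / 4 : R) <= 1 - n%:R^-1 by move: Q34; rewrite /Q; lra.
have P2 : 1 - n%:R^-1 <= Phi T by move: QT; rewrite /Q; lra.
have cont : {within `[3 / 4, T], continuous (@Phi R)}.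
  by apply: continuous_subspaceT => x;
    exact: derives_continuous (derives_Phi x).
have [|x _ Px] := @IVT R Phi (3 / 4) T (1 - n%:R^-1) T1 cont.
  by rewrite ge_min le_max P1 P2 orbT.
by exists x; rewrite div1r.
Unshelve. all: by end_near. Qed.

Lemma quantile_ge t n : (5 <= n)%N -> n%:R^-1 <= Q t -> t <= b_ n.
Proof.
move=> n5 nQ; rewrite leNgt; apply/negP => /Q_lt.
by rewrite Q_quantile// ltNge nQ.
Qed.

Lemma quantile_ge_of m n t : (0 < m)%N -> (5 <= n)%N -> (m <= n)%N ->
  m%:R^-1 <= Q t -> t <= b_ n.
Proof.
move=> m0 n5 mn mQ; apply: quantile_ge => //; apply: le_trans mQ.
by rewrite lef_pV2 ?posrE ?ltr0n ?ler_nat// (leq_trans m0).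
Qed.

Lemma quantile_ge_3_4 n : (5 <= n)%N -> 3 / 4 <= b_ n :> R.
Proof. by move=> n5; apply: (@quantile_ge_of 5) => //; exact: Q_3_4. Qed.

Lemma quantile_ge_1 n : (8 <= n)%N -> 1 <= b_ n :> R.
Proof.
by move=> n8; apply: (@quantile_ge_of 8) => //;
  [exact: leq_trans n8|exact: Q_1].
Qed.

Lemma quantile_ge_3_2 n : (16 <= n)%N -> 3 / 2 <= b_ n :> R.
Proof.
by move=> n8; apply: (@quantile_ge_of 16) => //;
  [exact: leq_trans n8|exact: Q_3_2].
Qed.

Lemma quantile_homo m n : (5 <= m)%N -> (m <= n)%N -> b_ m <= b_ n :> R.
Proof.
move=> m5 mn; apply: (@quantile_ge_of m) => //; rewrite ?Q_quantile//.
  exact: leq_trans m5.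
exact: leq_trans mn.
Qed.

Lemma ln_cumhaz n : (5 <= n)%N -> ln (n%:R : R) = cumhaz (b_ n).
Proof.
move=> n5; rewrite /cumhaz Q_quantile// lnV ?opprK// posrE ltr0n.
exact: leq_trans n5.
Qed.

(** From Q t <= phi t / t <= phi t, using phi 0 <= 1/2 <= e^(-1/2). *)
Lemma cumhaz_ge t : 1 <= t -> (t ^+ 2 + 1) / 2 <= cumhaz t.
Proof.
move=> t1; have t0 : 0 < t by lra.
suff h : Q t <= expR (- ((t ^+ 2 + 1) / 2)).
  by rewrite /cumhaz lerNr -ler_expR lnK ?posrE ?Q_gt0.
have e2 : 2^-1 <= expR (- 2^-1 : R) by have := @expR_ge1Dx R (- 2^-1); lra.
have h1 : Q t <= phi t.
  apply: le_trans (Q_le_phi t); rewrite ler_peMl//; exact/ltW/Q_gt0.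
apply: le_trans h1 _; rewrite phiE.
have -> : - ((t ^+ 2 + 1) / 2) = - 2^-1 + - (t ^+ 2 / 2) by field.
rewrite expRD ler_pM2r ?expR_gt0//; apply: le_trans e2.
rewrite lef_pV2 ?posrE ?sqrtr_gt0 ?mulr_gt0 ?pi_gt0//.
rewrite -[leLHS]ger0_norm// -sqrtr_sqr ler_wsqrtr//; have := @pi_ge2 R; lra.
Qed.

(** Between s and t the cumulative hazard grows by at most
(t^2 - s^2) / 2 + (t - s) / s <= (t^2 - s^2) (1 + s^-2) / 2, whereas
monotonicity of the ratio allows (t^2 - s^2) cumhaz s / s^2; [cumhaz_ge] is
exactly what makes the latter larger. *)
Lemma cumhaz_ratio_nincr s t : 1 <= s -> s <= t ->
  cumhaz t / t ^+ 2 <= cumhaz s / s ^+ 2.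
Proof.
move=> s1 st; have s0 : 0 < s by lra.
have t0 : 0 < t by lra.
have ts0 : 0 <= t - s by lra.
have := cumhaz_right_le s0 ts0; have -> : s + (t - s) = t by ring.
move=> h.
rewrite ler_pdivrMr ?exprn_gt0// mulrAC ler_pdivlMr ?exprn_gt0//.
have L := cumhaz_ge s1.
have k : s^-1 * (t - s) * s ^+ 2 = s * (t - s) by field; rewrite gt_eqF.
have s2 : 0 < s ^+ 2 by rewrite exprn_gt0.
have h2 : cumhaz t * s ^+ 2 <=
  (cumhaz s + (s + s^-1) * (t - s) + (t - s) ^+ 2 / 2) * s ^+ 2.
  by rewrite ler_pM2r//; lra.
have h3 : (t ^+ 2 - s ^+ 2) * ((s ^+ 2 + 1) / 2) <=
  (t ^+ 2 - s ^+ 2) * cumhaz s.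
  rewrite ler_wpM2l//. rewrite subr_ge0 lerXn2r ?nnegrE//; lra.
have h4 : s * (t - s) <= (t ^+ 2 - s ^+ 2) / 2.
  have := sqr_ge0 (t - s); lra.
have -> : cumhaz s * t ^+ 2 = cumhaz s * s ^+ 2 + (t ^+ 2 - s ^+ 2) * cumhaz s
  by ring.
apply: le_trans h2 _.
have -> : (cumhaz s + (s + s^-1) * (t - s) + (t - s) ^+ 2 / 2) * s ^+ 2 =
  cumhaz s * s ^+ 2 + (t ^+ 2 - s ^+ 2) / 2 * s ^+ 2 + s^-1 * (t - s) * s ^+ 2.
  by field; rewrite gt_eqF.
rewrite k; lra.
Qed.

(** From ln (n / m) <= n / m - 1 and ln m >= 1. *)
Lemma ln_ratio_nincr m n : (3 <= m)%N -> (m <= n)%N ->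
  ln (n%:R : R) / n%:R <= ln m%:R / m%:R.
Proof.
move=> m3 mn.
have m0 : 0 < m%:R :> R by rewrite ltr0n (leq_trans _ m3).
have mnR : m%:R <= n%:R :> R by rewrite ler_nat.
have n0 : 0 < n%:R :> R by apply: lt_le_trans mnR.
have l1 : 1 <= ln (m%:R : R).
  rewrite -ler_expR lnK ?posrE//; apply: (@le_trans _ _ 3);
    last by rewrite (ler_nat _ 3).
  exact: expR1_le3.
have h : ln (n%:R : R) <= ln m%:R + (n%:R / m%:R - 1).
  have p : 1 <= n%:R / m%:R :> R by rewrite ler_pdivlMr// mul1r.
  have -> : ln (n%:R : R) = ln m%:R + ln (1 + (n%:R / m%:R - 1)).
    by rewrite -lnM ?posrE//; [congr ln; field; rewrite gt_eqF|lra].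
  rewrite lerD2l; apply: le_ln1Dx; lra.
rewrite ler_pdivrMr// mulrAC.
apply: le_trans h _.
have -> : ln m%:R * n%:R / m%:R = ln m%:R + ln m%:R * (n%:R / m%:R - 1) :> R.
  by field; rewrite gt_eqF.
rewrite lerD2l ler_peMl// subr_ge0 ler_pdivlMr// mul1r//.
Qed.

End Quantile.

(** * The constant and the main theorem *)

Section Constant.
Context {R : realType}.
Implicit Types (m n : nat).

Lemma sqrt_expR1 : 3 / 2 <= Num.sqrt (expR 1 : R) <= 7 / 4.
Proof.
have e1 := @expR1_ge R.
have e2 := @expR1_le3 R.
rewrite -[3 / 2]ger0_norm ?divr_ge0// -[7 / 4]ger0_norm ?divr_ge0// -!sqrtr_sqr.
apply/andP; split; apply: ler_wsqrtr => //; lra.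
Qed.

(** The second branch of the constant, on all indices. *)
Definition Cfun n : R :=
  (2 / (3 * b_ n ^+ 2) + 1 / (Num.sqrt (expR 1) * n%:R)) * ln n%:R.

Lemma CboundE n : (16 <= n)%N -> Cbound n = Cfun n :> R.
Proof. by move=> n16; rewrite /Cbound leqNgt n16. Qed.

Lemma CfunE n : (5 <= n)%N -> Cfun n = 2 / 3 * (cumhaz (b_ n) / b_ n ^+ 2)
  + (Num.sqrt (expR 1))^-1 * (ln n%:R / n%:R).
Proof.
move=> n5; rewrite /Cfun -ln_cumhaz//.
have b34 := @quantile_ge_3_4 R n n5.
have /andP[s1 _] := sqrt_expR1.
have h1 : 0 < Num.sqrt (expR 1 : R) by lra.
have h2 : 0 < b_ n :> R by lra.
have h3 : 0 < n%:R :> R by rewrite ltr0n (leq_trans _ n5).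
by field; rewrite !gt_eqF.
Qed.

Lemma Cfun_nincr m n : (8 <= m)%N -> (m <= n)%N -> Cfun n <= Cfun m.
Proof.
move=> m8 mn.
have /andP[s1 _] := sqrt_expR1.
rewrite !CfunE; [|lia|lia].
apply: lerD.
  rewrite ler_pM2l; last lra.
  apply: cumhaz_ratio_nincr; first exact: quantile_ge_1.
  by apply: quantile_homo => //; lia.
rewrite ler_pM2l; last by rewrite invr_gt0; lra.
by apply: ln_ratio_nincr => //; lia.
Qed.

Lemma Cfun16_lt1 : Cfun 16 < 1.
Proof.
have b32 := @quantile_ge_3_2 R 16 isT.
have b2 : 9 / 4 <= (b_ 16 : R) ^+ 2.
  by apply: (@pow_ge _ _ (3 / 2)); lra.
have /andP[s1 _] := sqrt_expR1.
have l16 : ln (16%:R : R) <= 14 / 5.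
  have -> : 16%:R = 2 ^+ 4 :> R by rewrite -natrX.
  rewrite lnXn// -[_ *+ 4]mulr_natl; have := @ln2_le R; lra.
have l0 : 0 <= ln (16%:R : R) by rewrite ln_ge0// ler1n.
have h1 : 2 / (3 * (b_ 16) ^+ 2) <= 8 / 27 :> R.
  rewrite ler_pdivrMr; lra.
have h2 : 1 / (Num.sqrt (expR 1) * 16%:R) <= 24^-1 :> R.
  rewrite ler_pdivrMr; lra.
apply: (@le_lt_trans _ _ ((8 / 27 + 24^-1) * (14 / 5))); last lra.
rewrite /Cfun; apply: ler_pM => //; last exact: lerD.
by rewrite addr_ge0// divr_ge0// mulr_ge0//; lra.
Qed.

Lemma Cbound_lt1 n : (16 <= n)%N -> Cbound n < 1 :> R.
Proof.
move=> n16; rewrite CboundE//; apply: le_lt_trans Cfun16_lt1.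
by apply: Cfun_nincr.
Qed.

Lemma cumhaz_le t : 3 / 2 <= t ->
  cumhaz t <= t ^+ 2 / 2 + t + cumhaz (3 / 2 : R).
Proof.
move=> t32; have h0 : 0 <= t - 3 / 2 by lra.
have := @cumhaz_right_le R (3 / 2) (t - 3 / 2) ltac:(lra) h0.
have -> : 3 / 2 + (t - 3 / 2) = t by ring.
have -> : (3 / 2)^-1 = 2 / 3 :> R by rewrite invf_div.
lra.
Qed.

(** The two-sided bound of the cumulative hazard gives
ln n / b^2 = 1/2 + O(1 / b). For the remainder, z^2 e^-z is bounded at
z = ln n, so ln n / n = O(1 / ln n), and ln n is at least b / 2. *)
Lemma Cfun_near_third : exists2 K : R, 0 < K & forall n, (16 <= n)%N ->
  `|1 / 3 - Cfun n| <= K / b_ n.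
Proof.
set c := cumhaz (3 / 2 : R).
have c0 : 0 < c by have := @cumhaz_ge R (3 / 2) ltac:(lra); rewrite -/c; lra.
exists (2 / 3 * (1 + c) + 2); first lra.
move=> n n16; have n5 : (5 <= n)%N by lia.
have n0 : 0 < n%:R :> R by rewrite ltr0n; lia.
have t32 := @quantile_ge_3_2 R n n16.
rewrite CfunE//; set t : R := b_ n in t32 *.
have t0 : 0 < t by lra.
have tt : t <= t ^+ 2 by rewrite expr2 ler_peMr; lra.
have /andP[s1 _] := sqrt_expR1.
have L := @cumhaz_ge R t ltac:(lra).
have U := @cumhaz_le t t32.
have lo : 1 / 2 <= cumhaz t / t ^+ 2 by rewrite ler_pdivlMr ?exprn_gt0//; lra.
have hi : cumhaz t / t ^+ 2 <= 1 / 2 + (1 + c) / t.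
  rewrite ler_pdivrMr ?exprn_gt0//.
  have -> : (1 / 2 + (1 + c) / t) * t ^+ 2 = t ^+ 2 / 2 + t + c * t by field;
    rewrite gt_eqF.
  have : c * 1 <= c * t by rewrite ler_pM2l//; lra.
  rewrite -/c in U; lra.
have l0 : 0 < ln (n%:R : R) by rewrite ln_cumhaz// -/t; lra.
have r0 : 0 <= ln (n%:R : R) / n%:R by rewrite divr_ge0 ?ltW.
have r1 : ln (n%:R : R) / n%:R <= 2 / t.
  have h := @exprn_expRN_le _ (ln (n%:R : R)) 1 (ltW l0).
  rewrite expRN lnK ?posrE// in h.
  have lt : t / 2 <= ln (n%:R : R) by rewrite ln_cumhaz// -/t; lra.
  have k : ln (n%:R : R) / n%:R * (t / 2) <=
    ln (n%:R : R) / n%:R * ln (n%:R : R).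
    by rewrite ler_wpM2l.
  rewrite ler_pdivlMr//; lra.
have v0 : 0 <= (Num.sqrt (expR 1 : R))^-1 by rewrite invr_ge0; lra.
have v1 : (Num.sqrt (expR 1 : R))^-1 <= 1 by rewrite invf_le1; lra.
have p1 : (Num.sqrt (expR 1 : R))^-1 * (ln (n%:R : R) / n%:R) <= 2 / t.
  by rewrite -[leRHS]mul1r ler_pM.
have p0 := mulr_ge0 v0 r0.
have ti : 0 < t^-1 by rewrite invr_gt0.
rewrite distrC ler_norml; apply/andP; split; last lra.
have : 0 <= (2 / 3 * (1 + c) + 2) / t by rewrite divr_ge0//; lra.
lra.
Qed.

Lemma Cbound_cvg : (Cbound n : R) @[n --> \oo] --> (1 / 3 : R).
Proof.
have [K K0 HK] := Cfun_near_third.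
apply/cvgrPdist_le => e e0.
near=> n.
have n16 : (16 <= n)%N by near: n; exact: nbhs_infty_ge.
have t0 : 0 < (b_ n : R) by have := @quantile_ge_3_2 R n n16; lra.
rewrite CboundE//; apply: le_trans (HK n n16) _.
rewrite ler_pdivrMr// mulrC -ler_pdivrMr//.
have q0 := @Q_gt0 R (K / e).
apply: quantile_ge; first lia.
have nq : (Q (K / e))^-1 <= n%:R by near: n; exact: nbhs_infty_ger.
rewrite -[leRHS]invrK lef_pV2 ?posrE ?invr_gt0// (lt_le_trans _ nq)//
  invr_gt0//.
Unshelve. all: by end_near. Qed.

End Constant.

Section Uniform.
Context {R : realType}.

Let dist n (x : R) := `|Phi (acirc n * x + b_ n) ^+ n - Lambda x|.

Lemma deviation_le_ge16 n x : (16 <= n)%N ->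
  dist n x <= 3 / 5 / b_ n ^+ 2 + 4 / 7 / n%:R.
Proof.
move=> n16; have b32 := @quantile_ge_3_2 R n n16.
apply: deviation_large; [lra|lia|apply: Q_quantile; lia|].
by apply: (@pow_ge _ _ (3 / 2)); lra.
Qed.

(** Strict because 3/5 < 2/3, and 4/7 <= 1 / sqrt e. *)
Lemma large_bound_lt n : (16 <= n)%N ->
  3 / 5 / b_ n ^+ 2 + 4 / 7 / n%:R < Cfun n / ln n%:R :> R.
Proof.
move=> n16; have b32 := @quantile_ge_3_2 R n n16.
have /andP[s1 s2] := @sqrt_expR1 R.
have n0 : 0 < n%:R :> R by rewrite ltr0n; lia.
have B0 : 0 < (b_ n : R) ^+ 2 by rewrite exprn_gt0//; lra.
have l0 : 0 < ln (n%:R : R) by rewrite ln_gt0// ltr1n; lia.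
rewrite /Cfun mulfK ?gt_eqF//; apply: ltr_leD.
  have -> : 2 / (3 * b_ n ^+ 2) = 2 / 3 / b_ n ^+ 2 :> R by rewrite invfM mulrA.
  rewrite ltr_pM2r ?invr_gt0//; lra.
have -> : 1 / (Num.sqrt (expR 1) * n%:R) = 1 / Num.sqrt (expR 1) / n%:R :> R.
  by rewrite invfM mulrA.
rewrite ler_pM2r ?invr_gt0// mul1r -[leLHS]invf_div lef_pV2 ?posrE//; lra.
Qed.

Lemma deficit_odds_le (b D E : R) : deficit b <= D -> D < 1 -> 0 <= E ->
  D <= E * (1 - D) -> deficit b / (1 - deficit b) <= E.
Proof.
move=> dD D1 E0 DE; rewrite ler_pdivrMr; last lra.
by apply: (le_trans dD); apply: (le_trans DE); rewrite ler_wpM2l//; lra.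
Qed.

Lemma deviation_le_5_7 n x : (5 <= n <= 7)%N -> dist n x <= 49 / 100.
Proof.
move=> /andP[n5 n7]; have b34 := @quantile_ge_3_4 R n n5.
have b2 : 9 / 16 <= (b_ n : R) ^+ 2 by apply: (@pow_ge _ _ (3 / 4)); lra.
have b0 : 0 < b_ n :> R by lra.
apply: deviation_small => //; [lia|exact: Q_quantile| |lra].
have d1 : deficit (b_ n) <= 2^-1 :> R by apply: (@deficit_le _ _ (9 / 16)); lra.
have := @deficit_odds_le (b_ n) 2^-1 1 d1 ltac:(lra) ltac:(lra) ltac:(lra).
have : n%:R^-1 <= 5^-1 :> R by rewrite lef_pV2 ?posrE ?ltr0n// ?ler_nat//; lia.
lra.
Qed.

Lemma deviation_le_8_15 n x : (8 <= n <= 15)%N -> dist n x <= 31 / 100.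
Proof.
move=> /andP[n8 n15]; have b1 := @quantile_ge_1 R n n8.
have b2 : 1 <= (b_ n : R) ^+ 2 by apply: (@pow_ge _ _ 1); lra.
have b0 : 0 < b_ n :> R by lra.
apply: deviation_small => //; [lia|apply: Q_quantile; lia|lra| ].
have d1 : deficit (b_ n) <= 3^-1 :> R by apply: (@deficit_le _ _ 1); lra.
have := @deficit_odds_le (b_ n) 3^-1 2^-1 d1 ltac:(lra) ltac:(lra) ltac:(lra).
have : n%:R^-1 <= 8^-1 :> R by rewrite lef_pV2 ?posrE ?ltr0n// ?ler_nat//; lia.
lra.
Qed.

Lemma ln7_le2 : ln (7%:R : R) <= 2.
Proof.
rewrite -ler_expR lnK ?posrE ?ltr0n//.
have -> : 2 = 2%:R * 1 :> R by rewrite mulr1.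
rewrite expRM_natl; apply: (@pow_ge _ _ (27 / 10)); [lra|exact: expR1_ge|lra].
Qed.

Lemma ln15_le : ln (15%:R : R) <= 14 / 5.
Proof.
apply: (@le_trans _ _ (ln (2 ^+ 4))).
  by rewrite ler_ln ?posrE ?ltr0n ?exprn_gt0// -natrX ler_nat.
rewrite lnXn// -[_ *+ 4]mulr_natl; have := @ln2_le R; lra.
Qed.

(** The supremum is compared strictly, so a bound M uniform in x and strictly
below the target is what the theorem needs. *)
Lemma deviation_uniform n : (5 <= n)%N -> exists2 M, (forall x, dist n x <= M) &
  M < (if (n <= 15)%N then 1 else Cfun n) / ln n%:R.
Proof.
move=> n5.
have l0 : 0 < ln (n%:R : R) by rewrite ln_gt0// ltr1n; lia.
case: (leqP n 15) => [n15|n16]; last first.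
  eexists; last exact: large_bound_lt.
  by move=> x; exact: deviation_le_ge16.
have ln_mono m : (n <= m)%N -> ln (n%:R : R) <= ln m%:R.
  by move=> nm; rewrite ler_ln ?posrE ?ltr0n ?ler_nat//; lia.
case: (leqP n 7) => [n7|n8].
  exists (49 / 100); first by move=> x; apply: deviation_le_5_7; lia.
  rewrite ltr_pdivlMr//; have := ln_mono 7%N n7; have := ln7_le2; lra.
exists (31 / 100); first by move=> x; apply: deviation_le_8_15; lia.
rewrite ltr_pdivlMr//; have := ln_mono 15%N n15; have := ln15_le; lra.
Qed.

End Uniform.

Theorem theorem1 (R : realType) :
  [/\ (forall n0 : nat, (5 <= n0)%N ->
       forall n : nat, (n0 <= n)%N ->
       (ereal_sup
          [set `|Phi (acirc n * x + b_ n) ^+ n - Lambda x|%:E | x in [set: R]]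
        < (Cbound n0 / ln n%:R)%:E)%E),
      (forall n0 : nat, (16 <= n0)%N -> Cbound n0 < 1 :> R) &
      (Cbound n0 : R) @[n0 --> \oo] --> (1 / 3 : R)].
Proof.
split; [move=> n0 n05 n n0n|exact: Cbound_lt1|exact: Cbound_cvg].
have n5 : (5 <= n)%N by apply: leq_trans n0n.
have [M dM ltM] := @deviation_uniform R n n5.
apply: (@le_lt_trans _ _ M%:E).
  by apply: ge_ereal_sup => _ [x _ <-]; rewrite lee_fin; exact: dM.
rewrite lte_fin; apply: lt_le_trans ltM _.
have l0 : 0 < ln (n%:R : R) by rewrite ln_gt0// ltr1n; lia.
rewrite ler_pM2r ?invr_gt0//.
rewrite /Cbound; case: (leqP n0 15) => n0_15.
  case: (leqP n 15) => // n16; rewrite -CboundE//; exact/ltW/Cbound_lt1.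
rewrite leqNgt (leq_trans n0_15 n0n)/=.
by apply: Cfun_nincr => //; lia.
Qed.
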